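(* Let $t\ge1$ and $\beta>0$, and let $G$ be a connected $(U,W,\beta)$-bipartite graph with $|W|\ge t|U|$. Then $$\alpha'(G)\ge\min\left\{t/\beta^2,\,1\right\}\cdot|U|.$$
   Context: All graphs are finite, simple and nonempty. $\alpha'(G)$ is the matching number. For vertex sets $X,Y$, $e(X,Y)$ is the number of edges between $X$ and $Y$. A bipartite graph $G$ with bipartition $(U,W)$ is a $(U,W,\beta)$-bipartite graph if $\frac{|X||Y|}{(|U|-|X|)(|W|-|Y|)}\le\beta^2$ for every pair of subsets $X\subseteq U$, $Y\subseteq W$ with $e(X,Y)=0$. *)

(* Defs.v *)
From mathcomp Require Import all_boot all_order all_algebra.

Set Implicit Arguments.
Unset Strict Implicit.
Unset Printing Implicit Defensive.

Import Order.TTheory GRing.Theory Num.Theory.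
Local Open Scope ring_scope.

(* A graph is a relation [e] on a finite type [T] of vertices. Edges are
   unordered pairs, represented as the two-element sets [set x; y]. *)

Definition simple_graph (T : finType) (e : rel T) : Prop :=
  [/\ (0 < #|T|)%N, symmetric e & irreflexive e].

Definition connected_graph (T : finType) (e : rel T) : Prop :=
  forall x y : T, connect e x y.

Definition edges_between (T : finType) (e : rel T) (X Y : {set T})
  : {set {set T}} :=
  [set [set x; y] | x in X, y in Y & e x y].

Definition edge_set (T : finType) (e : rel T) : {set {set T}} :=
  edges_between e [set: T] [set: T].

Definition is_matching (T : finType) (e : rel T) (M : {set {set T}}) : bool :=
  (M \subset edge_set e) && trivIset M.

Definition matching_number (T : finType) (e : rel T) : nat :=
  (\max_(M : {set {set T}} | is_matching e M) #|M|)%N.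

Definition bipartition (T : finType) (e : rel T) (U W : {set T}) : Prop :=
  [/\ U :|: W = [set: T], [disjoint U & W] &
      forall x y : T, e x y ->
        (x \in U) && (y \in W) || (x \in W) && (y \in U)].

(* If X = U or Y = W the denominator vanishes and, since r / 0 = 0, the pair
   imposes no condition. In a connected graph with at least two vertices such
   a pair has the other set empty, so that the fraction reads 0 / 0. *)
Definition beta_bipartite (R : realFieldType) (T : finType) (e : rel T)
    (U W : {set T}) (beta : R) : Prop :=
  bipartition e U W /\
  forall X Y : {set T}, X \subset U -> Y \subset W ->
    #|edges_between e X Y| = 0%N ->
    (#|X|%:R * #|Y|%:R) / ((#|U|%:R - #|X|%:R) * (#|W|%:R - #|Y|%:R))
      <= beta ^+ 2.

(* Main.v *)
Require Import Defs.
From mathcomp Require Import all_boot all_order all_algebra.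
From mathcomp Require Import zify ring lra.

Import Order.TTheory GRing.Theory Num.Theory.
Local Open Scope ring_scope.

(** By König's theorem there is a vertex cover with at most [matching_number e]
    vertices; let [a] and [b] be its numbers of vertices in [U] and [W]. No edge
    joins the uncovered parts of [U] and [W], so [beta_bipartite] gives
    [(|U| - a) (|W| - b) <= beta^2 a b]. As [|W| >= t |U|], either
    [a + b >= |U|] or [beta^2 (a + b) >= t |U|].

    König's theorem is proved by deleting edges. If two edges share a vertex and
    deleting either one lowers the covering number, then the two smaller covers
    [(C, D)] and [(C', D')] uncross to [(C :|: C', D :&: D')] and
    [(C :&: C', D :|: D')], and one of these yields a cover of the whole graph
    that is too small. *)

Definition covers {T1 T2 : finType} (E : T1 -> T2 -> Prop)
    (C : {set T1}) (D : {set T2}) : Prop :=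
  forall x y, E x y -> (x \in C) || (y \in D).

Lemma covers_uncross (T1 T2 : finType) (E : T1 -> T2 -> Prop) (tau : nat)
    (x : T1) (y y' : T2) (C C' : {set T1}) (D D' : {set T2}) :
  (forall A B, covers E A B -> (tau <= #|A| + #|B|)%N) ->
  E x y -> E x y' -> y != y' ->
  covers (fun u v => E u v /\ (u, v) <> (x, y)) C D ->
  covers (fun u v => E u v /\ (u, v) <> (x, y')) C' D' ->
  (#|C| + #|D| < tau)%N -> (#|C'| + #|D'| < tau)%N -> False.
Proof.
move=> tauE Exy Exy' neq_yy' covC covC' ltC ltC'.
(* If [x] were in [C], the pair [(C, D)] would also cover the deleted edge [(x, y)], hence all of
   [E], with fewer than [tau] vertices. So the surviving edge [(x, y')] must be covered by [y'];
   symmetrically for [C'] and [D']. *)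
have xC : x \notin C.
  apply/negP => xC; have : covers E C D.
    move=> u v Euv; have [[-> _]|/eqP neq] := eqVneq (u, v) (x, y).
      by rewrite xC.
    exact: covC.
  by move/tauE; lia.
have xC' : x \notin C'.
  apply/negP => xC'; have : covers E C' D'.
    move=> u v Euv; have [[-> _]|/eqP neq] := eqVneq (u, v) (x, y').
      by rewrite xC'.
    exact: covC'.
  by move/tauE; lia.
have y'D : y' \in D.
  have /covC : E x y' /\ (x, y') <> (x, y).
    by split=> // -[eq_y]; rewrite eq_y eqxx in neq_yy'.
  by rewrite (negbTE xC).
have yD' : y \in D'.
  have /covC' : E x y /\ (x, y) <> (x, y').
    by split=> // -[eq_y]; rewrite eq_y eqxx in neq_yy'.
  by rewrite (negbTE xC').
have /tauE leI : covers E (C :&: C') (D :|: D').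
  move=> u v Euv; rewrite !inE.
  have [[-> ->]|/eqP neq] := eqVneq (u, v) (x, y); first by rewrite yD' !orbT.
  have [[-> ->]|/eqP neq'] := eqVneq (u, v) (x, y'); first by rewrite y'D orbT.
  by have /orP[->|->] := covC u v (conj Euv neq);
     have /orP[->|->] := covC' u v (conj Euv neq'); rewrite ?orbT.
(* Here the two deleted edges may be uncovered; adding their common end [x] repairs both at the cost
   of one vertex. *)
have /tauE leU : covers E (x |: (C :|: C')) (D :&: D').
  move=> u v Euv; rewrite !inE.
  have [//|neq_u] := eqVneq u x.
  have neq z : (u, v) <> (x, z) by case=> eq_u; rewrite eq_u eqxx in neq_u.
  by have /orP[->|->] := covC u v (conj Euv (neq y));
     have /orP[->|->] := covC' u v (conj Euv (neq y')); rewrite ?orbT.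
(* The two new covers have total size at most [2 * (tau - 1) + 1], so they cannot both reach
   [tau]. *)
have := cardsUI C C'; have := cardsUI D D'.
have := cardsU1 x (C :|: C'); case: (x \notin _) => /=; lia.
Qed.

(** Induction on the number of edges. The two sides are separate types, so edges are ordered pairs
    and a matching is a set of pairs on which both projections are injective. *)
Lemma konig (T1 T2 : finType) (E : {set T1 * T2}) :
  exists C D (M : {set T1 * T2}),
    [/\ covers (fun x y => (x, y) \in E) C D, M \subset E,
        {in M &, injective fst}, {in M &, injective snd} &
        (#|C| + #|D| <= #|M|)%N].
Proof.
have [n] := ubnP #|E|; elim: n => // n IHn in E *.
rewrite ltnS => leEn.
pose cov (c : {set T1} * {set T2}) :=
  [forall p in E, (p.1 \in c.1) || (p.2 \in c.2)].
have covP c : reflect (covers (fun x y => (x, y) \in E) c.1 c.2) (cov c).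
  apply: (iffP forall_inP) => [h x y /h //|h [x y] /h //].
have covT : cov (setT, setT) by apply/forall_inP => p _; rewrite inE.
case: (arg_minnP (fun c : {set T1} * {set T2} => #|c.1| + #|c.2|)%N covT).
move=> [C0 D0] /covP cov0 min0.
set tau := (#|(C0, D0).1| + #|(C0, D0).2|)%N in min0.
have tauE A B : covers (fun x y => (x, y) \in E) A B -> (tau <= #|A| + #|B|)%N.
  by move=> /(covP (A, B)) /min0.
suff [M [sME M1 M2 leM]] : exists M : {set T1 * T2},
    [/\ M \subset E, {in M &, injective fst}, {in M &, injective snd} &
        (tau <= #|M|)%N] by exists C0, D0, M; split.
(* The induction hypothesis for [E :\ p] gives a matching at least as large as some cover: either
   this matching already has [tau] edges, or that cover has fewer than [tau] vertices. *)
have del p : p \in E ->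
    (exists M : {set T1 * T2}, [/\ M \subset E, {in M &, injective fst},
       {in M &, injective snd} & (tau <= #|M|)%N]) \/
    (exists C D,
       covers (fun x y => (x, y) \in E /\ (x, y) <> p) C D /\
       (#|C| + #|D| < tau)%N).
  move=> pE; have [|C [D [M [covC sME M1 M2 leM]]]] := IHn (E :\ p).
    by move: leEn; rewrite (cardsD1 p E) pE.
  case: (leqP tau #|M|) => [le_tau|lt_tau].
    left; exists M; split=> //; exact: subset_trans sME (subsetDl _ _).
  right; exists C, D; split; last exact: leq_ltn_trans leM lt_tau.
  by move=> x y [xyE /eqP neq]; apply: covC; rewrite !inE neq.
have [/injectiveP inj1|/injectivePn] :=
  boolP (injectiveb (fun p : {p | p \in E} => (val p).1)); last first.
  case=> -[[x y] xyE] [[[x' y'] xyE'] neq /= eq_x].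
  rewrite -val_eqE /= in neq; subst x'.
  have neq_y : y != y' by apply: contraNneq neq => ->.
  have [//|[C [D [covC ltC]]]] := del _ xyE.
  have [//|[C' [D' [covC' ltC']]]] := del _ xyE'.
  by case: (covers_uncross _ _ (fun u v => (u, v) \in E) _ _ _ _ _ _ _ _
              tauE xyE xyE' neq_y covC covC' ltC ltC').
have [/injectiveP inj2|/injectivePn] :=
  boolP (injectiveb (fun p : {p | p \in E} => (val p).2)); last first.
  case=> -[[x y] xyE] [[[x' y'] xyE'] neq /= eq_y].
  rewrite -val_eqE /= in neq; subst y'.
  have neq_x : x != x' by apply: contraNneq neq => ->.
  have [//|[C [D [covC ltC]]]] := del _ xyE.
  have [//|[C' [D' [covC' ltC']]]] := del _ xyE'.
  (* The shared vertex is now on the second side, so the uncrossing is applied to the transposed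
     relation. *)
  exfalso; apply: (covers_uncross _ _ (fun v u => (u, v) \in E) tau
                     y x x' D D' C C') => //.
  - by move=> A B covAB; rewrite addnC; apply: tauE => u v /covAB; rewrite orbC.
  - move=> v u [uvE neq_uv]; rewrite orbC; apply: covC; split=> // -[eu ev].
    by apply: neq_uv; rewrite eu ev.
  - move=> v u [uvE neq_uv]; rewrite orbC; apply: covC'; split=> // -[eu ev].
    by apply: neq_uv; rewrite eu ev.
  - by rewrite addnC.
  - by rewrite addnC.
have fst_inj : {in E &, injective fst}.
  by move=> p q pE qE eq_pq; have [] := inj1 (Sub p pE) (Sub q qE) eq_pq.
have snd_inj : {in E &, injective snd}.
  by move=> p q pE qE eq_pq; have [] := inj2 (Sub p pE) (Sub q qE) eq_pq.
(* No two edges share a vertex, so [E] is itself a matching, and its first endpoints alone form a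
   cover of size [#|E|]. *)
exists E; split=> //; rewrite -(card_in_imset fst_inj) -[leqRHS]addn0.
rewrite -(cards0 T2); apply: tauE => x y xyE.
by apply/orP; left; apply/imsetP; exists (x, y).
Qed.

(** Passes from ordered pairs to two-element sets. As [U] and [W] are disjoint, a vertex common to
    two such sets is in the same position in both pairs, so injectivity of the projections
    identifies the pairs. *)
Lemma matching_number_ge_pairs (T : finType) (e : rel T) (U W : {set T})
    (M : {set T * T}) :
  [disjoint U & W] ->
  (forall p, p \in M -> [/\ p.1 \in U, p.2 \in W & e p.1 p.2]) ->
  {in M &, injective fst} -> {in M &, injective snd} ->
  (#|M| <= matching_number e)%N.
Proof.
move=> disUW MP M1 M2; pose f (p : T * T) := [set p.1; p.2].
have notUW z : z \in U -> z \in W -> False.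
  by move=> zU zW; have := disjointFr disUW zU; rewrite zW.
have share p q z : p \in M -> q \in M -> z \in f p -> z \in f q -> p = q.
  move=> pM qM; have [p1 p2 _] := MP p pM; have [q1 q2 _] := MP q qM.
  rewrite !inE => /orP[] /eqP -> /orP[] /eqP eq_pq.
  - exact: M1.
  - by case: (notUW p.1); rewrite // eq_pq.
  - by case: (notUW p.2); rewrite // eq_pq.
  - exact: M2.
have f_inj : {in M &, injective f}.
  move=> p q pM qM eq_f; apply: (share p q p.1) => //; first by rewrite !inE eqxx.
  by rewrite -eq_f !inE eqxx.
rewrite -(card_in_imset f_inj).
apply: (leq_bigmax_cond (F := fun N : {set {set T}} => #|N|)).
apply/andP; split.
  apply/subsetP => _ /imsetP[p pM ->]; have [_ _ ep] := MP p pM.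
  by apply/imset2P; exists p.1 p.2; rewrite ?inE.
apply/trivIsetP => _ _ /imsetP[p pM ->] /imsetP[q qM ->].
apply: contraR => /pred0Pn[z /andP[zp zq]].
by rewrite (share p q z).
Qed.

Lemma connected_neighbor {T : finType} {e : rel T} {x y : T} :
  connected_graph e -> x != y -> exists z, e x z.
Proof.
move=> conn neq; have /connectP[[|z p] /=] := conn x y.
  by move=> _ eq_y; rewrite eq_y eqxx in neq.
by case/andP => exz _ _; exists z.
Qed.

Lemma cover_size_bound (R : realFieldType) (t B u w a b : R) :
  1 <= t -> 0 < B -> 0 < a -> 0 < b -> t * u <= w ->
  (u - a) * (w - b) <= B * (a * b) ->
  Num.min (t / B) 1 * u <= a + b.
Proof.
move=> t1 B0 a0 b0 tuw H.
have [le_u|lt_u] := leP u (a + b).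
  have [u0|u0] := leP 0 u.
    by apply: le_trans le_u; apply: ler_piMl => //; rewrite ge_min lexx orbT.
  have m0 : 0 <= Num.min (t / B) 1.
    by rewrite le_min ler01 andbT divr_ge0 // ltW // (lt_le_trans ltr01).
  by nra.
have u0 : 0 <= u by lra.
apply: (@le_trans _ _ (t / B * u)); first by rewrite ler_wpM2r // ge_min lexx.
rewrite mulrAC ler_pdivrMr // -(ler_pM2r (mulr_gt0 a0 b0)).
have ub : t * (u - b) <= w - b by nra.
have H1 : (u - a) * (t * (u - b)) <= B * (a * b).
  by apply: le_trans H; apply: ler_wpM2l => //; lra.
(* Equality holds at [u = a + b], so [u - a - b] factors out of the difference; the cofactor is
   nonnegative once [u >= a + b]. *)
have key : u * (a * b) <= (u - a) * (u - b) * (a + b).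
  rewrite -subr_ge0.
  have -> : (u - a) * (u - b) * (a + b) - u * (a * b) =
    (u - a - b) * ((u - a - b) * (a + b) + (a ^+ 2 + a * b + b ^+ 2)) by ring.
  have c0 : 0 <= u - a - b by lra.
  have [a_ge0 b_ge0] := (ltW a0, ltW b0).
  apply: mulr_ge0 => //; apply: addr_ge0.
    by apply: mulr_ge0 => //; apply: addr_ge0.
  by rewrite !addr_ge0 ?exprn_ge0 ?mulr_ge0.
have H2 : (u - a) * (t * (u - b)) * (a + b) <= B * (a * b) * (a + b).
  by apply: ler_wpM2r => //; lra.
have H3 : t * (u * (a * b)) <= t * ((u - a) * (u - b) * (a + b)).
  by apply: ler_wpM2l => //; lra.
lra.
Qed.

Theorem theorem5p1 (R : realFieldType) (T : finType) (e : rel T)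
    (U W : {set T}) (t beta : R)
    (ht : 1 <= t) (hbeta : 0 < beta)
    (hG : simple_graph e) (hconn : connected_graph e)
    (hbip : beta_bipartite e U W beta)
    (hUW : t * #|U|%:R <= #|W|%:R) :
  Num.min (t / beta ^+ 2) 1 * #|U|%:R <= (matching_number e)%:R.
Proof.
have [_ e_sym _] := hG; have [[_ disUW eUW] hbeta2] := hbip.
have B0 : 0 < beta ^+ 2 by rewrite exprn_gt0.
have [U0|[u uU]] := set_0Vmem U; first by rewrite U0 cards0 mulr0.
have leUW : (#|U| <= #|W|)%N.
  by rewrite -(ler_nat R); apply: le_trans hUW; rewrite ler_peMl.
have [w wW] : exists w, w \in W.
  by apply/set0Pn; rewrite -card_gt0; apply: leq_trans leUW; apply/card_gt0P; exists u.
have notUW z : z \in U -> z \in W -> False.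
  by move=> zU zW; have := disjointFr disUW zU; rewrite zW.
have neq_UW x y : x \in U -> y \in W -> x != y.
  by move=> xU yW; apply/eqP => eq_xy; apply: (notUW x); rewrite // eq_xy.
pose E := [set p : T * T | [&& p.1 \in U, p.2 \in W & e p.1 p.2]].
have [C [D [M [covCD sME M1 M2 leM]]]] := konig _ _ E.
have {}leM : (#|U :&: C| + #|W :&: D| <= matching_number e)%N.
  apply: (@leq_trans #|M|).
    by apply: leq_trans leM; rewrite leq_add // subset_leq_card // subsetIr.
  apply: (matching_number_ge_pairs _ _ U W) => // p /(subsetP sME).
  by rewrite inE => /and3P[].
have cov x y : x \in U -> y \in W -> e x y -> (x \in C) || (y \in D).
  by move=> xU yW exy; apply: covCD; rewrite inE xU yW.
have min_le1 : (#|U| <= #|U :&: C| + #|W :&: D|)%N ->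
    Num.min (t / beta ^+ 2) 1 * #|U|%:R <= (matching_number e)%:R.
  move=> le_u; apply: (@le_trans _ _ #|U|%:R).
    by apply: ler_piMl => //; rewrite ge_min lexx orbT.
  by rewrite ler_nat (leq_trans le_u).
(* If the cover misses one side, it contains the whole other side, since by connectedness every
   vertex has a neighbor; this gives at least [#|U|] vertices. *)
have [a0|a_gt0] := posnP #|U :&: C|.
  apply: min_le1; apply: leq_trans leUW _; apply: leq_trans (leq_addl _ _).
  apply/subset_leq_card/subsetP => y yW; rewrite inE yW /=.
  have [|x eyx] := connected_neighbor hconn (y := u) (x := y).
    by rewrite eq_sym neq_UW.
  have xU : x \in U.
    by have /orP[/andP[yU _]|/andP[]//] := eUW _ _ eyx; case: (notUW y).
  have := cov x y xU yW; rewrite e_sym => /(_ eyx) /orP[xC|//].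
  by move/cards0_eq/setP/(_ x): a0; rewrite !inE xU xC.
have [b0|b_gt0] := posnP #|W :&: D|.
  apply: min_le1; apply: leq_trans (leq_addr _ _).
  apply/subset_leq_card/subsetP => x xU; rewrite inE xU /=.
  have [y exy] := connected_neighbor hconn (neq_UW _ _ xU wW).
  have yW : y \in W.
    by have /orP[/andP[]//|/andP[xW _]] := eUW _ _ exy; case: (notUW x).
  have /orP[//|yD] := cov x y xU yW exy.
  by move/cards0_eq/setP/(_ y): b0; rewrite !inE yW yD.
have noedge : #|edges_between e (U :\: C) (W :\: D)| = 0%N.
  apply/eqP; rewrite cards_eq0 -subset0; apply/subsetP => s.
  case/imset2P => x y; rewrite !inE => /andP[xC xU] /andP[/andP[yD yW] exy].
  by have := cov x y xU yW exy; rewrite (negbTE xC) (negbTE yD).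
(* The denominator becomes [#|U :&: C| * #|W :&: D|], which is positive after the two cases above,
   so the division is a genuine one and can be cleared. *)
have := hbeta2 _ _ (subsetDl U C) (subsetDl W D) noedge.
have cardD (A B : {set T}) : #|A :\: B|%:R = #|A|%:R - #|A :&: B|%:R :> R.
  by rewrite -(cardsID B A) natrD addrC addKr.
rewrite !cardD !subKr => H.
apply: (@le_trans _ _ (#|U :&: C|%:R + #|W :&: D|%:R)); last first.
  by rewrite -natrD ler_nat.
apply: (cover_size_bound _ _ _ _ #|W|%:R); rewrite ?ltr0n //.
by rewrite -ler_pdivrMr // mulr_gt0 // ltr0n.
Qed.
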